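(* Let $c\in\mathbb F_q$ be such that $x^2-x-c\in\mathbb F_q[x]$ is irreducible, let $\theta\in\mathbb F_{q^2}$ be a root of it, and let $t\ge 2$ be an integer such that every prime factor of $t$ divides $q^2-1$. Let $g(x)\in\mathbb F_q[x]$ be an irreducible polynomial of degree $n$ such that $g(-\theta)\ne0$. If $n$ is even, let $r(x)\in\mathbb F_{q^2}[x]$ be an irreducible factor of $g(x)$ in $\mathbb F_{q^2}[x]$. Define $g_0=g$ and $g_m=g_{m-1}^{Q_{c,t}}$ for $m\ge1$. If $n$ is odd (resp. if $n$ is even), assume that for all primes $\ell\mid t$, the element $\frac{g(-\theta^q)}{g(-\theta)}$ (resp. $\frac{r(-\theta^q)}{r(-\theta)}$) is not an $\ell$-th power in $\mathbb F_{q^2}$. Then, if $n$ is odd or if $4\mid nt$, all polynomials $g_m$, $m\ge0$, are irreducible in $\mathbb F_q[x]$.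
   Context: $\mathbb F_q$ is the finite field with $q$ elements. With $c,\theta,t$ as in the statement, set $$f(x)=\frac{\theta(x+\theta^q)^t-\theta^q(x+\theta)^t}{\theta^q-\theta},\qquad h(x)=\frac{(x+\theta)^t-(x+\theta^q)^t}{\theta^q-\theta};$$ both polynomials belong to $\mathbb F_q[x]$. For a nonzero polynomial $g(x)\in\mathbb F_q[x]$, set $$g^{Q_{c,t}}(x)=h(x)^{\deg g}\, g\left(\frac{f(x)}{h(x)}\right).$$ The element $0$ counts as an $\ell$-th power. *)

(* Defs.v *)
From HB Require Import structures.
From mathcomp Require Import all_boot all_algebra all_field.

Set Implicit Arguments.
Unset Strict Implicit.
Unset Printing Implicit Defensive.

Import GRing.Theory.
Local Open Scope ring_scope.

Section Transform.
Variables (F : finFieldType) (L : fieldExtType F).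
Implicit Types (g : {poly F}) (theta : L) (t : nat).

Definition QnumL theta t : {poly L} :=
  (theta ^+ #|F| - theta)^-1 *:
    (theta *: ('X + (theta ^+ #|F|)%:P) ^+ t
       - theta ^+ #|F| *: ('X + theta%:P) ^+ t).

Definition QdenL theta t : {poly L} :=
  (theta ^+ #|F| - theta)^-1 *:
    (('X + theta%:P) ^+ t - ('X + (theta ^+ #|F|)%:P) ^+ t).

(* Inverse of the embedding map_poly (in_alg L), for polynomials over L whose
   coefficients lie in F (any other coefficient is sent to 0). *)
Definition descend (p : {poly L}) : {poly F} :=
  map_poly (fun y : L => odflt 0 [pick a : F | a%:A == y]) p.

(* The polynomials f and h over F; see Qnum_embed and Qden_embed. *)
Definition Qnum theta t : {poly F} := descend (QnumL theta t).
Definition Qden theta t : {poly F} := descend (QdenL theta t).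

(* h ^ deg g * g (f / h) with denominators cleared; see QtransE. *)
Definition Qtrans theta t g : {poly F} :=
  \sum_(i < size g)
    g`_i *: (Qnum theta t ^+ i * Qden theta t ^+ ((size g).-1 - i)).

Lemma QtransE theta t g : Qden theta t != 0 ->
  tofrac (Qtrans theta t g) =
    tofrac (Qden theta t) ^+ (size g).-1
    * (map_poly (fun a : F => tofrac a%:P) g).[tofrac (Qnum theta t)
                                               / tofrac (Qden theta t)].
Proof.
move=> h0; have H0 : tofrac (Qden theta t) != 0 by rewrite tofrac_eq0.
have -> : map_poly (fun a : F => tofrac a%:P) g
        = map_poly (@tofrac _ \o polyC) g by [].
rewrite horner_coef size_map_poly mulr_sumr /Qtrans rmorph_sum /=.
apply: eq_bigr => i _; rewrite coef_map /= -mul_polyC !rmorphM /= !rmorphXn /=.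
rewrite [RHS]mulrCA; congr (_ * _).
have le_i : (i <= (size g).-1)%N.
  by rewrite -ltnS (ltn_predK (ltn_ord i)).
rewrite exprMn exprVn [RHS]mulrCA; congr (_ * _).
by rewrite expfB_cond // (negbTE H0).
Qed.

Lemma descendK (p : {poly L}) :
  (forall i, p`_i ^+ #|F| = p`_i) -> map_poly (in_alg L) (descend p) = p.
Proof.
move=> pF; apply/polyP => i; rewrite coef_map /= /descend coef_map_id0; last first.
  case: pickP => //= a; rewrite -in_algE fmorph_eq0 => /eqP -> //.
have : p`_i \in (1%AS : {subfield L}).
  by rewrite Fermat's_little_theorem dimv1 expn1 pF.
case/vlineP => a ->; case: pickP => [b /eqP // | /(_ a)].
by rewrite eqxx.
Qed.

Variables (c : F) (theta : L) (t : nat).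
Hypotheses (dimL : \dim {:L} = 2%N)
  (irr : irreducible_poly ('X^2 - 'X - c%:P))
  (th : root (map_poly (in_alg L) ('X^2 - 'X - c%:P)) theta).

Let frob (x : L) := x ^+ #|F|.

Let frob_zmod : zmod_morphism frob.
Proof.
rewrite /frob => x y.
have [p _ pcharFp] := finPcharP F; rewrite (card_pprimeChar pcharFp).
elim: (logn _ _) => // n IHn; rewrite expnSr !exprM {}IHn.
by rewrite -(pchar_lalg L) in pcharFp; rewrite -pFrobenius_autE rmorphB.
Qed.

Let frob_monoid : monoid_morphism frob.
Proof. by rewrite /frob; split=> [|x y]; rewrite ?exprMn ?expr1n. Qed.

Let frob_ex : {f : {rmorphism L -> L} | f =1 frob}.
Proof.
pose f : {rmorphism L -> L} :=
  HB.pack frob (GRing.isZmodMorphism.Build L L frob frob_zmod)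
    (GRing.isMonoidMorphism.Build L L frob frob_monoid).
by exists f.
Qed.

Let frobM : {rmorphism L -> L} := sval frob_ex.

Let frobE x : frobM x = x ^+ #|F|. Proof. exact: (svalP frob_ex x). Qed.

Let frobK x : frob (frob x) = x.
Proof.
have : x \in ({:L}%AS : {subfield L}) by rewrite memvf.
by rewrite Fermat's_little_theorem dimL expnS expn1 exprM => /eqP.
Qed.

Lemma conj_neq : theta ^+ #|F| - theta != 0.
Proof.
rewrite subr_eq0; apply/negP => fixt.
have : theta \in (1%AS : {subfield L}).
  by rewrite Fermat's_little_theorem dimv1 expn1.
case/vlineP => a def_th; move: th; rewrite def_th -in_algE fmorph_root => ra.
have sz : size ('X^2 - 'X - c%:P) = 3%N.
  rewrite -addrA size_polyDl ?size_polyXn // -opprD size_polyN size_polyDl.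
    by rewrite size_polyX.
  by rewrite size_polyX ltnS size_polyC leq_b1.
case: irr => _ /(_ ('X - a%:P)).
rewrite size_XsubC dvdp_XsubCl => /(_ isT ra) /eqp_size.
by rewrite size_XsubC sz.
Qed.

Let frob_conj : frobM (theta ^+ #|F|) = theta.
Proof. by rewrite frobE -[LHS]/(frob (frob theta)) frobK. Qed.

Let frob_inv : frobM (theta ^+ #|F| - theta)^-1 = - (theta ^+ #|F| - theta)^-1.
Proof. by rewrite fmorphV rmorphB frob_conj frobE -invrN opprB. Qed.

Let frob_pow a : map_poly frobM (('X + a%:P) ^+ t) = ('X + (frobM a)%:P) ^+ t.
Proof. by rewrite rmorphXn rmorphD /= map_polyX map_polyC. Qed.

Lemma Qnum_embed : map_poly (in_alg L) (Qnum theta t) = QnumL theta t.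
Proof.
apply: descendK => i; rewrite -frobE -coef_map; congr (_`_ _).
rewrite /QnumL map_polyZ rmorphB /= !map_polyZ /= !frob_pow frob_inv frob_conj.
by rewrite frobE scaleNr -scalerN opprB.
Qed.

Lemma Qden_embed : map_poly (in_alg L) (Qden theta t) = QdenL theta t.
Proof.
apply: descendK => i; rewrite -frobE -coef_map; congr (_`_ _).
rewrite /QdenL map_polyZ rmorphB /= !frob_pow frob_inv frob_conj.
by rewrite frobE scaleNr -scalerN opprB.
Qed.

Lemma Qden_neq0 : (2 <= t)%N ->
  (forall l : nat, prime l -> (l %| t)%N -> (l %| #|F| ^ 2 - 1)%N) ->
  Qden theta t != 0.
Proof.
move=> t2 ht; have t0 : (0 < t)%N by exact: ltnW.
rewrite -(map_poly_eq0 (in_alg L)) Qden_embed.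
apply/negP => /eqP /(congr1 (fun p : {poly L} => p`_t.-1)); rewrite coef0.
rewrite /QdenL coefZ coefB => /eqP; rewrite mulf_eq0 invr_eq0 (negbTE conj_neq) /=.
have cf (a : L) : (('X + a%:P) ^+ t)`_t.-1 = a *+ t.
  have top n : (('X + a%:P) ^+ n)`_n = 1 /\ (('X + a%:P) ^+ n)`_n.+1 = 0.
    have sz : size (('X + a%:P) ^+ n) = n.+1.
      by rewrite -(opprK a) polyCN size_exp_XsubC.
    split; last by rewrite nth_default ?sz.
    have mon : ('X + a%:P) ^+ n \is monic.
      by rewrite -(opprK a) polyCN monic_exp ?monicXsubC.
    by move/monicP: mon; rewrite lead_coefE sz.
  rewrite -[in LHS](prednK t0) -[in RHS](prednK t0).
  elim: t.-1 => [|n IHn]; first by rewrite expr1 coefD coefX coefC add0r.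
  rewrite exprS mulrDl coefD coefXM coefCM /= IHn.
  by rewrite (top n.+1).1 mulr1 -mulrSr.
rewrite !cf -mulrnBl -opprB mulNrn oppr_eq0 -mulr_natl mulf_eq0 (negbTE conj_neq) orbF.
have [p pr_p pcharFp] := finPcharP F.
rewrite -(pchar_lalg L) in pcharFp; rewrite -(dvdn_pcharf pcharFp) => /(ht p pr_p).
have pF : (p %| #|F| ^ 2)%N.
  rewrite (pchar_lalg L) in pcharFp; rewrite (card_pprimeChar pcharFp).
  move: (finNzRing_gt1 F); rewrite (card_pprimeChar pcharFp).
  by case: (logn _ _) => [|k] //; rewrite pfactorK // !dvdn_exp ?dvdnn.
rewrite dvdn_subr // ?expn_gt0 ?(ltnW (finNzRing_gt1 F)) //.
by rewrite dvdn1 => /eqP p1; rewrite p1 in pr_p.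
Qed.

End Transform.

(* Main.v *)
From HB Require Import structures.
Require Import Defs.
From mathcomp Require Import all_boot all_algebra all_field.
From mathcomp Require Import zify.

(* Put a = theta, b = theta^q, Q = q^2 and M(y) = (y + b) / (y + a).  Since
   f + a h = - (x + a)^t and f + b h = - (x + b)^t, the rational map f / h is
   conjugate under M to y |-> y^t: a root x of g_m lies over a root z of g with
   M(x)^(t^m) = M(z).  In an algebraic closure, degrees over a finite field are
   read off the Frobenius: the root x of an irreducible polynomial of degree d
   over F_q satisfies x^(q^k) = x iff d | k.  Let z be a root of r (r = g when
   n is odd), of degree d over F_Q.  The norm of M(z) down to F_Q is
   r(-b) / r(-a), so M(z) is not an l-th power in F_Q(z) for any prime l | t;
   Kummer theory, applied to one prime at a time, shows that M(x) has degree
   d t^m over F_Q.  The usual condition on 4 is automatic because - 1 is a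
   square in F_Q.  Passing from F_Q down to F_q gives degree n t^m for x, which
   is the degree of g_m. *)

Set Implicit Arguments.
Unset Strict Implicit.
Unset Printing Implicit Defensive.

Import GRing.Theory.
Local Open Scope ring_scope.

Lemma dvdp_map_root (F S : fieldType) (j : {rmorphism F -> S})
    (e p : {poly F}) x :
  e %| p -> root (map_poly j e) x -> root (map_poly j p) x.
Proof.
by rewrite -(dvdp_map j) => /dvdpP[r ->] ex; rewrite rootM ex orbT.
Qed.

(** * Frobenius orbits and degrees over a finite field *)

Section Frobenius.
Variables (F : finFieldType) (S : fieldType) (j : {rmorphism F -> S}).
Local Notation q := #|F|%N.
Implicit Types (x y : S) (p e : {poly F}) (k s : nat).

(** S inherits the characteristic p of F, and q^k is a power of p. Packed as a morphism, the q^k-th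
    power commutes with evaluation and products. *)
Lemma frobenius_rmorphism k :
  exists f : {rmorphism S -> S}, forall x, f x = x ^+ (q ^ k).
Proof.
have [p _ pcharF] := finPcharP F; have pcharS := rmorph_pchar j pcharF.
have fB : zmod_morphism (fun x : S => x ^+ (q ^ k)).
  move=> x y; rewrite (card_pprimeChar pcharF) -expnM.
  elim: (_ * k)%N => [|n IHn]; first by rewrite !expr1.
  by rewrite expnSr !exprM IHn -pFrobenius_autE rmorphB.
have fM : monoid_morphism (fun x : S => x ^+ (q ^ k)).
  by split=> [|x y]; rewrite ?exprMn ?expr1n.
pose f : {rmorphism S -> S} :=
  HB.pack (fun x : S => x ^+ (q ^ k)) (GRing.isZmodMorphism.Build S S _ fB)
    (GRing.isMonoidMorphism.Build S S _ fM).
by exists f.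
Qed.

Lemma image_frobenius k (a : F) : j a ^+ (q ^ k) = j a.
Proof.
elim: k => [|k IHk]; first by rewrite expr1.
by rewrite expnSr exprM IHk -rmorphXn expf_card.
Qed.

(** X^q - X splits over F into the factors X - a, so all its roots in S come from F. *)
Lemma fixed_in_image x : x ^+ q = x -> exists a, x = j a.
Proof.
move=> xq; have : root (map_poly j ('X^q - 'X)) x.
  by rewrite rmorphB /= map_polyXn map_polyX rootE !hornerE xq subrr.
rewrite finField_genPoly rmorph_prod rootE horner_prod => /prodf_eq0[a _].
by rewrite /= map_polyXsubC hornerXsubC subr_eq0 => /eqP ->; exists a.
Qed.

Lemma poly_in_image (P : {poly S}) : (forall i, P`_i ^+ q = P`_i) ->
  exists p, P = map_poly j p.
Proof.
move=> Pq; have Pim i : exists a, j a == P`_i.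
  by have [a ->] := fixed_in_image (Pq i); exists a.
exists (\poly_(i < size P) xchoose (Pim i)); apply/polyP => i.
rewrite coef_map coef_poly /=; case: ltnP => [_ | leP].
  by rewrite (eqP (xchooseP (Pim i))).
by rewrite nth_default // rmorph0.
Qed.

Lemma horner_frobenius k p x :
  (map_poly j p).[x] ^+ (q ^ k) = (map_poly j p).[x ^+ (q ^ k)].
Proof.
have [f fE] := frobenius_rmorphism k.
rewrite -!fE -horner_map -map_poly_comp; congr (_.[_]).
by apply: eq_map_poly => a /=; rewrite fE image_frobenius.
Qed.

Lemma root_frobenius k p x :
  root (map_poly j p) x -> root (map_poly j p) (x ^+ (q ^ k)).
Proof.
rewrite !rootE -horner_frobenius => /eqP ->.
by rewrite expr0n expn_eq0 -leqn0 leqNgt (ltnW (finNzRing_gt1 F)).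
Qed.

Lemma expr_frobenius_inj k : injective (fun x : S => x ^+ (q ^ k)).
Proof.
have [f fE] := frobenius_rmorphism k.
by move=> x y; rewrite -!fE => /fmorph_inj.
Qed.

Lemma expr_frobenius_mod d k x :
  x ^+ (q ^ d) = x -> x ^+ (q ^ (k * d)) = x.
Proof.
by move=> xd; elim: k => [|k IHk]; rewrite ?expr1 // mulSn expnD exprM xd.
Qed.

Lemma irreducible_root_dvdp e p x : irreducible_poly e ->
  root (map_poly j e) x -> root (map_poly j p) x -> e %| p.
Proof.
move=> irr_e ex px; apply: contraLR px => /negbTE Nep.
have: coprimep (map_poly j e) (map_poly j p).
  by rewrite coprimep_map irreducible_poly_coprime // Nep.
by move/coprimep_root => /(_ x ex).
Qed.

(** If s is the degree of x over F, this is the minimal polynomial of x. *)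
Definition orbit_poly s x : {poly S} := \prod_(i < s) ('X - (x ^+ (q ^ i))%:P).

Lemma size_orbit_poly s x : size (orbit_poly s x) = s.+1.
Proof. by rewrite size_prod_XsubC -[index_enum _]enumT size_enum_ord. Qed.

(** The Frobenius permutes the s factors cyclically, hence fixes every coefficient of the
    product. *)
Lemma orbit_poly_in_image s x : x ^+ (q ^ s) = x ->
  exists p, orbit_poly s x = map_poly j p.
Proof.
move=> xs; apply: poly_in_image => i; have [f fE] := frobenius_rmorphism 1.
have -> (y : S) : y ^+ q = f y by rewrite fE expn1.
rewrite -coef_map; congr (_`_ _); rewrite rmorph_prod /=.
under eq_bigr do rewrite map_polyXsubC fE -exprM -expnSr.
case: s xs => [|s] xs; first by rewrite /orbit_poly !big_ord0.
by rewrite /orbit_poly big_ord_recr big_ord_recl /= xs expr1 mulrC.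
Qed.

(** Since s > 0, the factor of index 0 makes x a root; the product descends to F, where the
    irreducible e must divide it. *)
Lemma dvdp_orbit_poly s e x : irreducible_poly e -> root (map_poly j e) x ->
  (0 < s)%N -> x ^+ (q ^ s) = x -> map_poly j e %| orbit_poly s x.
Proof.
move=> irr_e ex; case: s => // s _ xs; have [p Dp] := orbit_poly_in_image xs.
rewrite Dp dvdp_map (irreducible_root_dvdp irr_e ex) // -Dp.
by rewrite /orbit_poly big_ord_recl expr1 rootM root_XsubC eqxx.
Qed.

Lemma frobenius_order_ge s e x : irreducible_poly e ->
  root (map_poly j e) x -> (0 < s)%N -> x ^+ (q ^ s) = x ->
  ((size e).-1 <= s)%N.
Proof.
move=> irr_e ex s_gt0 xs; have := dvdp_orbit_poly irr_e ex s_gt0 xs.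
move/dvdp_leq; rewrite -size_poly_eq0 size_orbit_poly size_map_poly => /(_ isT).
by case: (size e).
Qed.

(** Pigeonhole: the d + 1 powers x^(q^i), i <= d, are roots of e, so two of them coincide.
    Injectivity of the Frobenius gives 0 < s <= d with x^(q^s) = x, and the lower bound on s forces
    s = d. *)
Lemma frobenius_order_size e x : irreducible_poly e ->
  root (map_poly j e) x -> x ^+ (q ^ (size e).-1) = x.
Proof.
move=> irr_e ex; set d := (size e).-1.
have e_gt1 : (1 < size e)%N := irr_e.1.
have de : size e = d.+1 by rewrite (ltn_predK e_gt1).
have [s s_gt0 [le_sd xs]] :
    exists2 s, (0 < s)%N & (s <= d)%N /\ x ^+ (q ^ s) = x.
  pose rs := [seq x ^+ (q ^ i) | i <- iota 0 d.+1].
  have : ~~ uniq rs.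
    have e0 : map_poly j e != 0 by rewrite map_poly_eq0 irredp_neq0.
    have rs_root : all (root (map_poly j e)) rs.
      by apply/allP => _ /mapP[i _ ->]; apply: root_frobenius.
    apply/negP => /(max_poly_roots e0 rs_root).
    by rewrite size_map_poly size_map size_iota de ltnn.
  case/(uniqPn 0) => i [k [lt_ik]]; rewrite size_map size_iota => lt_kd.
  have lt_id := ltn_trans lt_ik lt_kd.
  rewrite !(nth_map 0) ?size_iota // !nth_iota // !add0n => eq_ik.
  exists (k - i)%N; first by rewrite subn_gt0.
  split; first by rewrite leq_subLR (leq_trans _ (leq_addl _ _)).
  by apply: (@expr_frobenius_inj i); rewrite -exprM -expnD subnK ?(ltnW lt_ik).
by have := frobenius_order_ge irr_e ex s_gt0 xs; rewrite -/d => le_ds;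
  rewrite (@anti_leq d s) // le_ds.
Qed.

(** Divide k by d: the multiple of d acts trivially on x, and a nonzero remainder m < d with x^(q^m)
    = x would contradict the lower bound. *)
Lemma frobenius_order e x : irreducible_poly e -> root (map_poly j e) x ->
  forall k, (x ^+ (q ^ k) == x) = ((size e).-1 %| k)%N.
Proof.
move=> irr_e ex k; set d := (size e).-1.
have d_gt0 : (0 < d)%N by rewrite -ltnS prednK ?(ltnW irr_e.1) ?irr_e.1.
have xd := frobenius_order_size irr_e ex.
rewrite {1}(divn_eq k d) addnC expnD exprM; rewrite /dvdn.
have [-> | m_gt0] := posnP (k %% d).
  by rewrite expr1 expr_frobenius_mod ?eqxx.
have lt_md : (k %% d < d)%N by rewrite ltn_mod.
apply/negbTE/negP => /eqP xk.
have xm : x ^+ (q ^ (k %% d)) = x.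
  by apply: (@expr_frobenius_inj (k %/ d * d)); rewrite xk expr_frobenius_mod.
by have := frobenius_order_ge irr_e ex m_gt0 xm; rewrite leqNgt lt_md.
Qed.

Lemma irreducible_orbit_poly e x : irreducible_poly e ->
  root (map_poly j e) x ->
  map_poly j e = lead_coef (map_poly j e) *: orbit_poly (size e).-1 x.
Proof.
move=> irr_e ex; have xd := frobenius_order_size irr_e ex.
have e_gt0 := ltnW irr_e.1.
have d_gt0 : (0 < (size e).-1)%N by rewrite -ltnS prednK ?irr_e.1.
have /eqpP[[c1 c2] /= /andP[c1_neq0 c2_neq0] eq12] :
    map_poly j e %= orbit_poly (size e).-1 x.
  rewrite -(dvdp_size_eqp (dvdp_orbit_poly irr_e ex d_gt0 xd)).
  by rewrite size_map_poly size_orbit_poly prednK.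
have /(congr1 lead_coef) := eq12; rewrite !lead_coefZ.
have /monicP -> : orbit_poly (size e).-1 x \is monic by apply: monic_prod_XsubC.
rewrite mulr1 => Dc2; apply: (scalerI c1_neq0).
by rewrite eq12 -Dc2 scalerA.
Qed.

End Frobenius.

(** * Norm exponents and Kummer theory *)

(** This is (Q^D - 1) / (Q - 1): raising to this power is the norm from the extension of degree D
    down to the field with Q elements. *)
Definition repunit Q D := (\sum_(i < D) Q ^ i)%N.

Lemma repunit_gt0 Q D : (0 < D)%N -> (0 < repunit Q D)%N.
Proof. by case: D => // D _; rewrite /repunit big_ord_recl. Qed.

(** Transitivity of the norm at the level of exponents; both sides become Q^(lD) - 1 after
    multiplication by Q - 1. *)
Lemma repunit_mul Q l D : (1 < Q)%N ->
  repunit Q (l * D) = ((\sum_(i < l) Q ^ (i * D)) * repunit Q D)%N.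
Proof.
move=> Q_gt1; have Q1_gt0 : (0 < Q.-1)%N by rewrite -ltnS prednK // ltnW.
apply/eqP; rewrite -(eqn_pmul2l Q1_gt0) -predn_exp mulnCA -predn_exp.
rewrite [(l * D)%N]mulnC expnM predn_exp mulnC; apply/eqP; congr (_ * _)%N.
by apply: eq_bigr => i _; rewrite -expnM mulnC.
Qed.

(** Shows how the Q-th power moves y^([repunit Q D]): by the factor y^(Q^D - 1), when y is
    nonzero. *)
Lemma mul_repunit Q D : (Q * repunit Q D + 1 = repunit Q D + Q ^ D)%N.
Proof.
have -> : (repunit Q D + Q ^ D = repunit Q D.+1)%N.
  by rewrite /repunit big_ord_recr.
rewrite /repunit big_ord_recl addnC big_distrr /=; congr (_ + _)%N.
by apply: eq_bigr => i _; rewrite -expnS.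
Qed.

Section Kummer.
Variables (S : fieldType) (Q : nat).
Hypothesis Q_gt1 : (1 < Q)%N.

(** The condition y^Q = y singles out the elements of the field with Q elements without naming that
    field. *)
Definition norm_nonpower l (v : S) := forall y : S, y ^+ Q = y -> y ^+ l != v.

(* The norms agree up to the sign z^(l(l-1)/2), z an l-th root of unity; the
   squares absorb it. *)
Lemma kummer_step D l (x w : S) : prime l -> (l %| Q - 1)%N -> (0 < D)%N ->
  w ^+ l = x -> x ^+ (Q ^ D) = x -> norm_nonpower l (x ^+ repunit Q D) ->
  [/\ w ^+ (Q ^ (l * D)) = w,
      forall E, (D %| E)%N -> w ^+ (Q ^ E) = w -> (l * D %| E)%N
    & (w ^+ repunit Q (l * D)) ^+ 2 = (x ^+ repunit Q D) ^+ 2].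
Proof.
move=> pr_l l_dv_Q D_gt0 wl xD xN.
have l_gt0 := prime_gt0 pr_l.
have QD_gt0 : (0 < Q ^ D)%N by rewrite expn_gt0 ltnW.
(* If w = 0 then x = 0, and its norm 0 is the l-th power of 0. *)
have w_neq0 : w != 0.
  apply: contraTneq isT => w0; have := xN 0.
  have expr00 n : (0 < n)%N -> 0 ^+ n = 0 :> S.
    by case: n => // n _; rewrite expr0n.
  by rewrite -wl w0 !expr00 ?repunit_gt0 ?(ltnW Q_gt1) // eqxx => /(_ erefl).
(* The factor by which the Q^D-th power moves w. It is an l-th root of unity because w^l = x is
   fixed, and it is fixed by the Q-th power because l divides Q - 1. *)
pose z := w ^+ (Q ^ D).-1.
have wD : w ^+ (Q ^ D) = z * w by rewrite -exprSr prednK.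
have zl : z ^+ l = 1.
  have x_neq0 : x != 0 by rewrite -wl expf_neq0.
  apply: (mulIf x_neq0); rewrite mul1r -[in RHS]xD -(prednK QD_gt0) exprSr.
  by rewrite -wl -!exprM mulnC.
have zQ k : z ^+ (Q ^ k) = z.
  elim: k => [|k IHk]; rewrite ?expr1 // expnSr exprM IHk.
  rewrite -[in LHS](subnK (ltnW Q_gt1)) exprD expr1.
  by case/dvdnP: l_dv_Q => a ->; rewrite mulnC exprM zl expr1n mul1r.
(* If z = 1, then w^([repunit Q D]) is fixed by the Q-th power, and its l-th power is the norm of
   x. *)
have z_neq1 : z != 1.
  apply: contraTneq isT => z1; have := xN (w ^+ repunit Q D).
  rewrite -exprM -wl -!exprM [(l * _)%N]mulnC eqxx => -> //.
  apply: (mulIf w_neq0); rewrite -exprSr -addn1 mulnC mul_repunit.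
  by rewrite exprD wD z1 mul1r.
have z_prim : l.-primitive_root z.
  have [m prim_m] := prim_order_exists l_gt0 zl.
  case/primeP: (pr_l) => _ l_prime /l_prime/orP[] /eqP Dm; last by rewrite -Dm.
  have := prim_expr_order prim_m; rewrite Dm expr1 => z1.
  by rewrite z1 eqxx in z_neq1.
have wjD k : w ^+ (Q ^ (k * D)) = z ^+ k * w.
  elim: k => [|k IHk]; first by rewrite expr1 mul1r.
  by rewrite mulSn addnC expnD exprM IHk exprMn wD exprAC zQ mulrA -exprSr.
split.
- by rewrite wjD zl mul1r.
- move=> _ /dvdnP[k ->]; rewrite wjD -[RHS]mul1r => /(mulIf w_neq0)/eqP.
  by rewrite -(prim_order_dvd z_prim) dvdn_pmul2r.
rewrite repunit_mul // exprM.
have -> : w ^+ (\sum_(i < l) Q ^ (i * D))%N = z ^+ (\sum_(i < l) i)%N * x.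
  rewrite expr_sum; under eq_bigr do rewrite wjD.
  by rewrite big_split /= prodrXr prodr_const card_ord wl.
have z2 : z ^+ ((\sum_(i < l) i) * 2) = 1.
  rewrite -(big_mkord xpredT (fun i : nat => i)) bin2_sum.
  (* Twice the binomial coefficient is the falling factorial l (l - 1), a multiple of l. *)
  by rewrite -[2%N]/(2`!)%N bin_ffact ffactnS exprM zl expr1n.
rewrite exprMn exprMn -[RHS]mul1r; congr (_ * _).
by rewrite exprAC -(exprM z) z2 expr1n.
Qed.
(** Induction on T: with l the least prime factor and T = U l, the element v = w^U satisfies v^l = x
    and [kummer_step] raises D to l D; then v replaces x and U replaces T. The nonpower condition is
    on squares because the step preserves the norm only up to sign. *)
Lemma kummer_degree T D (x w : S) : (0 < T)%N -> (0 < D)%N ->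
  (forall l, prime l -> (l %| T)%N -> (l %| Q - 1)%N) ->
  (forall l, prime l -> (l %| T)%N ->
     forall y, y ^+ Q = y -> (y ^+ l) ^+ 2 != (x ^+ repunit Q D) ^+ 2) ->
  w ^+ T = x -> x ^+ (Q ^ D) = x ->
  forall E, (D %| E)%N -> w ^+ (Q ^ E) = w -> (D * T %| E)%N.
Proof.
have [n leTn] := ubnP T; elim: n => // n IHn in T D x leTn *.
move=> T_gt0 D_gt0 T_dv xN wT xD E D_dv_E wE.
have [T_le1 | T_gt1] := leqP T 1.
  by rewrite (_ : T = 1)%N ?muln1 //; apply/anti_leq; rewrite T_le1.
have pr_l := pdiv_prime T_gt1; set l := pdiv T in pr_l.
have [U DT] := dvdnP (pdiv_dvd T); rewrite -/l in DT.
have l_dv_T : (l %| T)%N by rewrite DT dvdn_mull.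
have U_gt0 : (0 < U)%N by move: T_gt0; rewrite DT muln_gt0 => /andP[].
have vl : (w ^+ U) ^+ l = x by rewrite -exprM -DT.
have xN1 : norm_nonpower l (x ^+ repunit Q D).
  by move=> y yQ; apply: contraNneq (xN l pr_l l_dv_T y yQ) => ->.
have [vD v_ord v_norm] := kummer_step pr_l (T_dv l pr_l l_dv_T) D_gt0 vl xD xN1.
have lD_dv_E : (l * D %| E)%N by rewrite v_ord // exprAC wE.
have U_dv_T : (U %| T)%N by rewrite DT dvdn_mulr.
have ltUn : (U < n)%N.
  apply: leq_trans (_ : T <= n)%N; last by rewrite -ltnS.
  by rewrite DT -[X in (X < _)%N]muln1 ltn_pmul2l ?prime_gt1.
rewrite DT mulnA mulnC mulnA.
apply: (IHn _ _ _ ltUn U_gt0 _ _ _ erefl vD) => //.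
- by rewrite muln_gt0 prime_gt0.
- by move=> k pr_k k_dv_U; apply: T_dv; rewrite // (dvdn_trans k_dv_U).
move=> k pr_k k_dv_U; rewrite v_norm; apply: xN => //.
exact: dvdn_trans U_dv_T.
Qed.
End Kummer.

(** * An irreducibility test, roots of -1, and homogeneous substitution *)

(** A nonconstant divisor of least size is irreducible, so a bound on irreducible divisors bounds
    all of them. *)
Lemma irreducible_of_factor_size (F : fieldType) (p : {poly F}) :
  (1 < size p)%N ->
  (forall e, irreducible_poly e -> e %| p -> (size p <= size e)%N) ->
  irreducible_poly p.
Proof.
move=> p_gt1 le_p; have p_neq0 : p != 0 by rewrite -size_poly_gt0 ltnW.
have le_size (e : {poly F}) : size e != 1 -> e %| p -> (size p <= size e)%N.
  have [n] := ubnP (size e); elim: n e => // n IHn e le_en e_neq1 e_dv_p.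
  have e_neq0 : e != 0 by apply: dvdpN0 e_dv_p p_neq0.
  have [// | lt_ep] := leqP (size p) (size e).
  suff irr_e : irreducible_poly e.
    by have := le_p e irr_e e_dv_p; rewrite leqNgt lt_ep.
  split.
    by rewrite ltn_neqAle eq_sym e_neq1 size_poly_gt0.
  move=> d d_neq1 d_dv_e; rewrite -dvdp_size_eqp // eqn_leq dvdp_leq //=.
  case: leqP => // lt_de; have d_dv_p := dvdp_trans d_dv_e e_dv_p.
  have := IHn d (leq_trans lt_de le_en) d_neq1 d_dv_p.
  by rewrite leqNgt (ltn_trans lt_de lt_ep).
split=> // e e_neq1 e_dv_p.
by rewrite -dvdp_size_eqp // eqn_leq dvdp_leq // le_size.
Qed.

(** For odd l take -1. For l = 2 the order of K is odd, so 4 divides it minus 1 and a square root of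
    -1, being a fourth root of unity, is fixed by the Frobenius and lies in K. *)
Lemma exp_root_opp1 (K : finFieldType) l :
  prime l -> (l %| #|K| - 1)%N -> ~~ odd #|K| || (4 %| #|K| - 1)%N ->
  exists u : K, u ^+ l = -1.
Proof.
move=> pr_l l_dv_K cardK.
have [l2 | l_odd] := even_prime pr_l; last first.
  by exists (-1); rewrite -signr_odd l_odd expr1.
have K_gt0 : (0 < #|K|)%N := ltnW (finNzRing_gt1 K).
have {cardK} K4 : (4 %| #|K| - 1)%N.
  by case/orP: cardK => // K_even; move: l_dv_K; rewrite l2; lia.
have [S [j _]] := countable_algebraic_closure K.
have /closed_rootP[u] : size (map_poly j ('X^2 + 1)) != 1.
  by rewrite size_map_poly size_polyDl ?size_polyXn ?size_poly1.
rewrite rmorphD /= map_polyXn rmorph1 rootE !hornerE addr_eq0 => /eqP u2.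
have u4 : u ^+ 4 = 1 by rewrite (exprM u 2 2) u2 sqrrN expr1n.
have [|v Dv] := @fixed_in_image K S j u.
  rewrite -(subnK K_gt0) exprD expr1.
  by case/dvdnP: K4 => k ->; rewrite mulnC exprM u4 expr1n mul1r.
by exists v; apply: (fmorph_inj j); rewrite rmorphXn l2 -Dv u2 rmorphN1.
Qed.

(** The transform [Qtrans] for arbitrary f and h; on [Qnum] and [Qden] the two agree by
    conversion. *)
Definition homog_subst (F : fieldType) (f h g : {poly F}) : {poly F} :=
  \sum_(k < size g) g`_k *: (f ^+ k * h ^+ ((size g).-1 - k)).

(** With n = deg g, the term k = n has degree n t; any other has degree at most k t + (n - k)(t - 1)
    < n t. *)
Lemma size_homog_subst (F : fieldType) (f h g : {poly F}) t : (0 < t)%N ->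
  size f = t.+1 -> (size h <= t)%N -> g != 0 ->
  size (homog_subst f h g) = ((size g).-1 * t).+1.
Proof.
move=> t_gt0 szf szh g_neq0.
have szg : size g = (size g).-1.+1 by rewrite prednK ?size_poly_gt0.
move: (lead_coef_eq0 g); rewrite /homog_subst lead_coefE (negbTE g_neq0).
move: (size g).-1 szg => n -> gn; rewrite big_ord_recr /= addrC subnn mulr1.
have f_neq0 : f != 0 by rewrite -size_poly_gt0 szf.
have sz_top : size (g`_n *: f ^+ n) = (n * t).+1.
  rewrite size_scale ?gn // -[LHS]prednK ?size_poly_gt0 ?expf_neq0 //.
  by rewrite size_exp szf mulnC.
rewrite size_polyDl sz_top // ltnS; apply: (leq_trans (size_sum _ _ _)).
apply/bigmax_leqP => k _; apply: (leq_trans (size_scale_leq _ _)).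
apply: (leq_trans (size_polyMleq _ _)).
have := size_poly_exp_leq f k; have := size_poly_exp_leq h (n - k).
rewrite szf /=; have := ltn_ord k.
have le_h : ((size h).-1 * (n - k) <= t.-1 * (n - k))%N.
  by rewrite leq_mul // -!subn1 leq_sub2r.
move=> lt_kn szhk szfk.
have -> : (n * t = k * t + (n - k) * t)%N by rewrite -mulnDl subnKC // ltnW.
have : (t.-1 * (n - k) + (n - k) = (n - k) * t)%N.
  by rewrite addnC -mulSn prednK // mulnC.
have nk_gt0 : (0 < n - k)%N by rewrite subn_gt0.
move: szfk szhk le_h nk_gt0; rewrite [(t * k)%N]mulnC.
move: (size (f ^+ _)) (size (h ^+ _)) => x y.
move: (_ * _)%N (_ * _)%N (_ * _)%N => u v z.
lia.
Qed.

Lemma horner_homog_subst (F S : fieldType) (J : {rmorphism F -> S})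
    (f h g : {poly F}) (x : S) :
  (map_poly J (homog_subst f h g)).[x] =
    \sum_(k < size g) J g`_k * ((map_poly J f).[x] ^+ k *
                                (map_poly J h).[x] ^+ ((size g).-1 - k)).
Proof.
rewrite rmorph_sum horner_sum; apply: eq_bigr => k _.
by rewrite /= linearZ /= rmorphM !rmorphXn !hornerE.
Qed.

(** * Roots over the quadratic extension K of F *)

Section QuadraticExtension.
Variables (F K : finFieldType) (i : {rmorphism F -> K}).
Hypothesis cardK : #|K| = (#|F| ^ 2)%N.
Variables (S : closedFieldType) (j : {rmorphism K -> S}).
Local Notation q := #|F|.
Let J : {rmorphism F -> S} := j \o i.

Lemma map_poly_tower (p : {poly F}) : map_poly J p = map_poly j (map_poly i p).
Proof. by rewrite map_poly_comp. Qed.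

Lemma root_over_extension (p : {poly F}) (r : {poly K}) x :
  r %| map_poly i p -> root (map_poly j r) x -> root (map_poly J p) x.
Proof.
by rewrite map_poly_tower; apply: dvdp_map_root.
Qed.

Lemma poly_root (p : {poly K}) : (1 < size p)%N ->
  exists x, root (map_poly j p) x.
Proof.
by move=> p_gt1; apply/closed_rootP; rewrite size_map_poly; case: ltngtP p_gt1.
Qed.

(** A root of an irreducible factor of degree s over K is fixed by the q^(2s)-th power, so n divides
    2s, and s since n is odd. *)
Lemma irreducible_odd_extension (g : {poly F}) : irreducible_poly g ->
  odd (size g).-1 -> irreducible_poly (map_poly i g).
Proof.
move=> irr_g n_odd; apply: irreducible_of_factor_size.
  by rewrite size_map_poly irr_g.1.
move=> e irr_e e_dv_g; have [x ex] := poly_root irr_e.1.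
have gx := root_over_extension e_dv_g ex.
have := frobenius_order_size irr_e ex; rewrite cardK -expnM => /eqP.
rewrite (frobenius_order irr_g gx) Gauss_dvdr ?coprimen2 // => /dvdn_leq le_ge.
have e_gt0 : (0 < (size e).-1)%N by have := irr_e.1; lia.
rewrite size_map_poly -(prednK (ltnW irr_g.1)) -(prednK (ltnW irr_e.1)) ltnS.
exact: le_ge.
Qed.

(** * The rational map f / h and its conjugacy with the t-th power *)

Variables (a b : K) (f h : {poly F}) (t : nat).
Hypotheses (t_gt0 : (0 < t)%N) (ab : a != b).
Hypothesis fhA : map_poly i f + a *: map_poly i h = - ('X + a%:P) ^+ t.
Hypothesis fhB : map_poly i f + b *: map_poly i h = - ('X + b%:P) ^+ t.

Local Notation fJ := (map_poly J f).
Local Notation hJ := (map_poly J h).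

Lemma horner_fhA x : fJ.[x] + j a * hJ.[x] = - (x + j a) ^+ t.
Proof.
have := congr1 (fun p => (map_poly j p).[x]) fhA.
rewrite !(rmorphD, rmorphN, rmorphXn) /= linearZ /= map_polyX map_polyC.
by rewrite !hornerE !map_poly_tower.
Qed.

Lemma horner_fhB x : fJ.[x] + j b * hJ.[x] = - (x + j b) ^+ t.
Proof.
have := congr1 (fun p => (map_poly j p).[x]) fhB.
rewrite !(rmorphD, rmorphN, rmorphXn) /= linearZ /= map_polyX map_polyC.
by rewrite !hornerE !map_poly_tower.
Qed.

Lemma monic_shift_exp (c : K) : ('X + c%:P) ^+ t \is monic.
Proof. by rewrite -[c]opprK polyCN monic_exp ?monicXsubC. Qed.

Lemma size_shift_exp (c : K) : size (('X + c%:P) ^+ t) = t.+1.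
Proof. by rewrite -[c]opprK polyCN size_exp_XsubC. Qed.

(** Subtracting the two identities gives (a - b) h = (X + b)^t - (X + a)^t, where the leading terms
    cancel. *)
Lemma size_den : (size h <= t)%N.
Proof.
have Dh : (a - b) *: map_poly i h = ('X + b%:P) ^+ t - ('X + a%:P) ^+ t.
  transitivity ((map_poly i f + a *: map_poly i h)
                - (map_poly i f + b *: map_poly i h)).
    by rewrite opprD addrACA subrr add0r scalerBl.
  by rewrite fhA fhB opprK addrC.
rewrite -(size_map_poly i) -(size_scale _ (_ : a - b != 0)) ?subr_eq0 // Dh.
apply/leq_sizeP => k; rewrite leq_eqVlt => /orP[/eqP <- | lt_tk].
  rewrite coefB.
  have /monicP := monic_shift_exp a; rewrite lead_coefE size_shift_exp => ->.
  have /monicP := monic_shift_exp b; rewrite lead_coefE size_shift_exp => ->.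
  by rewrite subrr.
by rewrite coefB !nth_default ?subrr ?size_shift_exp.
Qed.

Lemma size_num : size f = t.+1.
Proof.
rewrite -(size_map_poly i).
have -> : map_poly i f = - ('X + a%:P) ^+ t - a *: map_poly i h.
  by rewrite -fhA addrK.
rewrite size_polyDl !size_polyN size_shift_exp //.
by rewrite ltnS (leq_trans (size_scale_leq _ _)) // size_map_poly size_den.
Qed.

(** At a zero of h the value is 0 by the convention on division, so compatibility with Frobenius
    holds everywhere. *)
Definition ratmap (x : S) : S := fJ.[x] / hJ.[x].

Lemma ratmap_frobenius k x : ratmap (x ^+ (q ^ k)) = ratmap x ^+ (q ^ k).
Proof. by rewrite /ratmap expr_div_n !horner_frobenius. Qed.

Lemma iter_ratmap_frobenius k m x :
  iter m ratmap (x ^+ (q ^ k)) = iter m ratmap x ^+ (q ^ k).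
Proof. by elim: m => //= m ->; rewrite ratmap_frobenius. Qed.

(** If h(x) = 0, only the top term survives and forces f(x) = 0; then x + a and x + b both vanish,
    against a != b. Otherwise divide by the power of h(x). *)
Lemma root_homog_subst (g : {poly F}) x : g != 0 ->
  root (map_poly J (homog_subst f h g)) x ->
  root (map_poly J g) (ratmap x) /\ hJ.[x] != 0.
Proof.
move=> g_neq0; rewrite rootE horner_homog_subst.
have [h0 | h_neq0] := eqVneq hJ.[x] 0.
  have -> : \sum_(k < size g)
        J g`_k * (fJ.[x] ^+ k * hJ.[x] ^+ ((size g).-1 - k)) =
      J (lead_coef g) * fJ.[x] ^+ (size g).-1.
    rewrite lead_coefE; have : (0 < size g)%N by rewrite size_poly_gt0.
    case: (size g) => //= n _.
    rewrite big_ord_recr /= subnn mulr1 big1 ?add0r //.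
    by move=> k _; rewrite h0 expr0n subn_eq0 leqNgt ltn_ord !mulr0.
  rewrite mulf_eq0 fmorph_eq0 lead_coef_eq0 (negbTE g_neq0) /=.
  rewrite expf_eq0 => /andP[_ /eqP f0]; case/negP: ab.
  have := horner_fhA x; have := horner_fhB x.
  rewrite f0 h0 !mulr0 addr0 => /eqP; rewrite eq_sym oppr_eq0 expf_eq0 t_gt0 /=.
  rewrite addr_eq0 => /eqP xb /eqP; rewrite eq_sym oppr_eq0 expf_eq0 t_gt0 /=.
  by rewrite addr_eq0 xb eqr_opp (inj_eq (fmorph_inj j)) eq_sym.
move=> /eqP sum0; split=> //; rewrite rootE horner_coef size_map_poly.
rewrite -(mulrI_eq0 _ (mulfI (expf_neq0 (size g).-1 h_neq0))) mulr_sumr.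
apply/eqP; rewrite -[RHS]sum0; apply: eq_bigr => k _.
rewrite coef_map /= mulrCA; congr (_ * _); rewrite /ratmap expr_div_n mulrCA.
congr (_ * _); have le_k : (k <= (size g).-1)%N.
  by rewrite -ltnS prednK // size_poly_gt0.
by rewrite -{1}(subnK le_k) exprD mulfK // expf_neq0.
Qed.

Lemma ratmapA x : hJ.[x] != 0 -> ratmap x + j a = - hJ.[x]^-1 * (x + j a) ^+ t.
Proof.
move=> h_neq0; rewrite mulNr -mulrN -horner_fhA /ratmap mulrDr.
by rewrite [in RHS]mulrC mulrCA mulVf ?mulr1.
Qed.

Lemma ratmapB x : hJ.[x] != 0 -> ratmap x + j b = - hJ.[x]^-1 * (x + j b) ^+ t.
Proof.
move=> h_neq0; rewrite mulNr -mulrN -horner_fhB /ratmap mulrDr.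
by rewrite [in RHS]mulrC mulrCA mulVf ?mulr1.
Qed.

Local Notation iterQ m g := (iter m (homog_subst f h) g).

Lemma size_iter_homog_subst (g : {poly F}) m : g != 0 ->
  size (iterQ m g) = ((size g).-1 * t ^ m).+1.
Proof.
move=> g_neq0; elim: m => [|m IHm] /=.
  by rewrite muln1 prednK ?size_poly_gt0.
rewrite (size_homog_subst t_gt0 size_num size_den).
  by rewrite IHm -mulnA -expnSr.
by rewrite -size_poly_gt0 IHm.
Qed.

Lemma iter_homog_subst_neq0 (g : {poly F}) m : g != 0 -> iterQ m g != 0.
Proof. by move=> g_neq0; rewrite -size_poly_gt0 size_iter_homog_subst. Qed.

(** The common factor u collects the powers of -1/h; keeping it avoids quotients whose denominators
    might vanish. *)
Lemma root_iter_homog_subst (g : {poly F}) m x : g != 0 ->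
  root (map_poly J (iterQ m g)) x ->
  root (map_poly J g) (iter m ratmap x) /\
  exists u, iter m ratmap x + j a = u * (x + j a) ^+ (t ^ m) /\
            iter m ratmap x + j b = u * (x + j b) ^+ (t ^ m).
Proof.
move=> g_neq0; elim: m x => [|m IHm] x.
  by split=> //; exists 1; rewrite !mul1r.
rewrite iterS => gx; rewrite !iterSr.
have [gy h_neq0] := root_homog_subst (iter_homog_subst_neq0 m g_neq0) gx.
have [gz [u [uA uB]]] := IHm _ gy; split=> //.
exists (u * (- hJ.[x]^-1) ^+ (t ^ m)).
by rewrite uA uB ratmapA // ratmapB // !exprMn -!exprM -expnS !mulrA.
Qed.


(** Evaluate r as its leading coefficient times the product of X - x^(Q^k): each factor at -c is
    minus a conjugate of x + c. The prefactor does not depend on c, so it cancels in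
    [norm_mobius]. *)
Lemma norm_shift (r : {poly K}) (c : K) x : irreducible_poly r ->
  root (map_poly j r) x ->
  j r.[- c] = lead_coef (map_poly j r) * (-1) ^+ (size r).-1 *
              (x + j c) ^+ repunit #|K| (size r).-1.
Proof.
move=> irr_r rx; rewrite -horner_map /=.
rewrite (irreducible_orbit_poly irr_r rx) hornerZ lead_coefZ.
rewrite (monicP (monic_prod_XsubC _ _ _)) mulr1 -mulrA; congr (_ * _).
rewrite horner_prod -[X in (-1) ^+ X]card_ord -prodr_const /repunit expr_sum.
rewrite -big_split /=; apply: eq_bigr => k _.
have [F1 F1E] := frobenius_rmorphism j k.
rewrite hornerXsubC mulN1r -!F1E rmorphD.
by rewrite [F1 (j c)]F1E image_frobenius rmorphN opprD addrC.
Qed.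

Lemma norm_mobius (r : {poly K}) x : irreducible_poly r ->
  root (map_poly j r) x ->
  ((x + j b) / (x + j a)) ^+ repunit #|K| (size r).-1 = j (r.[- b] / r.[- a]).
Proof.
move=> irr_r rx; rewrite fmorph_div !(norm_shift _ irr_r rx) expr_div_n.
by rewrite -mulf_div divff ?mul1r // mulf_neq0 ?signr_eq0 // lead_coef_eq0
  map_poly_eq0 irredp_neq0.
Qed.

Lemma iter_homog_subst_irreducible (g : {poly F}) (r : {poly K}) :
  irreducible_poly g -> (map_poly i g).[- a] != 0 ->
  irreducible_poly r -> r %| map_poly i g ->
  (forall l, prime l -> (l %| t)%N -> (l %| #|K| - 1)%N) ->
  (forall l, prime l -> (l %| t)%N -> forall y, y ^+ l != r.[- b] / r.[- a]) ->
  forall m, irreducible_poly (iterQ m g).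
Proof.
move=> irr_g ga irr_r r_dv_g t_dv nonpow m.
have g_neq0 := irredp_neq0 irr_g; have n_gt0 : (0 < (size g).-1)%N.
  by have := irr_g.1; case: (size g) => [|[]].
have d_gt0 : (0 < (size r).-1)%N by have := irr_r.1; case: (size r) => [|[]].
apply: irreducible_of_factor_size => [|e irr_e e_dv_g].
  by rewrite size_iter_homog_subst // ltnS muln_gt0 n_gt0 expn_gt0 t_gt0.
have e_gt0 : (0 < (size e).-1)%N by have := irr_e.1; case: (size e) => [|[]].
rewrite size_iter_homog_subst // -(prednK (ltnW irr_e.1)) ltnS.
have [z rz] := poly_root irr_r.1; have gz := root_over_extension r_dv_g rz.
(* Any root of e lies over some root of g, which is a Frobenius conjugate of z; conjugating the root
   of e moves it over z itself. *)
have [x ex zx] : exists2 x, root (map_poly J e) x & z = iter m ratmap x.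
  have /closed_rootP[x ex] : size (map_poly J e) != 1.
    by rewrite size_map_poly; have := irr_e.1; case: ltngtP.
  have gmx : root (map_poly J (iterQ m g)) x.
    exact: dvdp_map_root e_dv_g ex.
  have [gy _] := root_iter_homog_subst g_neq0 gmx.
  move: gz; rewrite (irreducible_orbit_poly irr_g gy).
  rewrite rootZ ?lead_coef_eq0 ?map_poly_eq0 //.
  rewrite rootE horner_prod => /prodf_eq0[k _].
  rewrite hornerXsubC subr_eq0 => /eqP ->; exists (x ^+ (q ^ k)).
    exact: root_frobenius.
  by rewrite iter_ratmap_frobenius.
have gmx : root (map_poly J (iterQ m g)) x by exact: dvdp_map_root e_dv_g ex.
have [_ [u []]] := root_iter_homog_subst g_neq0 gmx; rewrite -zx => uA uB.
have za_neq0 : z + j a != 0.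
  apply: contraNneq ga => /eqP; rewrite addr_eq0 -rmorphN => /eqP za.
  by rewrite -(fmorph_eq0 j) -horner_map -map_poly_tower -za.
have xa_neq0 : x + j a != 0.
  apply: contraNneq za_neq0 => xa; rewrite uA xa expr0n.
  by rewrite eqn0Ngt expn_gt0 t_gt0 mulr0.
pose w := (x + j b) / (x + j a).
have wz : w ^+ (t ^ m) = (z + j b) / (z + j a).
  have u_neq0 : u != 0 by apply: contraNneq za_neq0 => u0; rewrite uA u0 mul0r.
  by rewrite uA uB expr_div_n -mulf_div divff // mul1r.
have zd := frobenius_order_size irr_r rz.
have n_dv_2d : ((size g).-1 %| 2 * (size r).-1)%N.
  by rewrite -(frobenius_order irr_g gz) expnM -cardK zd.
have Kord k y : y ^+ (#|K| ^ k) = y ->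
    ((y + j b) / (y + j a)) ^+ (#|K| ^ k) = (y + j b) / (y + j a).
  move=> yk; have [F1 F1E] := frobenius_rmorphism j k.
  by rewrite -F1E fmorph_div !rmorphD !F1E !image_frobenius yk.
(* Kummer theory for w, with norm r(-b) / r(-a) for the image of z. *)
have d_dv E : x ^+ (#|K| ^ E) = x -> ((size r).-1 * t ^ m %| E)%N.
  move=> xE.
  have zE : z ^+ (#|K| ^ E) = z.
    by rewrite zx cardK -expnM -iter_ratmap_frobenius expnM -cardK xE.
  have l_dv_t l : prime l -> (l %| t ^ m)%N -> (l %| t)%N.
    by move=> pr_l; rewrite Euclid_dvdX // => /andP[].
  have wE : w ^+ (#|K| ^ E) = w by apply: Kord.
  apply: (kummer_degree (finNzRing_gt1 K) _ d_gt0 _ _ wz _ _ wE).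
  - by rewrite expn_gt0 t_gt0.
  - by move=> l pr_l l_dv; apply: t_dv (l_dv_t l pr_l l_dv).
  - move=> l pr_l /(l_dv_t l pr_l) l_dv y /(fixed_in_image j)[y0 ->].
    (* Equal squares leave y^l equal to the norm or to its opposite; an l-th root of -1 reduces the
       second case to the first. *)
    rewrite norm_mobius // -!rmorphXn (inj_eq (fmorph_inj j)) eqf_sqr negb_or.
    rewrite nonpow //=; have [|v vl] := exp_root_opp1 pr_l (t_dv l pr_l l_dv).
      (* For q = 2k + 1, q^2 - 1 = 4 k (k + 1). *)
      rewrite cardK oddX /= -implybE; apply/implyP => q_odd.
      have := divn_eq q 2; rewrite modn2 q_odd; move: (q %/ 2)%N => k ->.
      by apply/dvdnP; exists (k * k.+1)%N; rewrite -mulnn; lia.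
    apply: contra (nonpow l pr_l l_dv (v * y0)) => /eqP yl.
    by rewrite exprMn vl yl mulN1r opprK.
  - exact: Kord.
  by rewrite -(frobenius_order irr_r rz) zE.
have xe := frobenius_order_size irr_e ex.
(* For n odd, n divides d = deg r, and [d_dv] is applied with E = deg e. For n even, deg e is even
   and E = deg e / 2 is allowed; this makes up for n <= 2d. *)
have [n_odd | n_even] := boolP (odd (size g).-1).
  have n_dv_d : ((size g).-1 %| (size r).-1)%N.
    by move: n_dv_2d; rewrite Gauss_dvdr ?coprimen2.
  apply: leq_trans (dvdn_leq e_gt0 (d_dv _ _)).
    by rewrite leq_mul2r dvdn_leq ?orbT.
  by rewrite cardK -expnM expr_frobenius_mod.
have n_dv_e : ((size g).-1 %| (size e).-1)%N.
  by rewrite -(frobenius_order irr_g gz) zx -iter_ratmap_frobenius xe.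
have /dvdnP[k Dk] : (2 %| (size e).-1)%N.
  by apply: dvdn_trans n_dv_e; rewrite dvdn2.
have k_gt0 : (0 < k)%N by move: e_gt0; rewrite Dk muln_gt0 => /andP[].
have le_dk := dvdn_leq k_gt0 (d_dv k _).
rewrite Dk; apply: leq_trans (_ : (2 * (size r).-1) * t ^ m <= _)%N.
  by rewrite leq_mul2r dvdn_leq ?orbT // muln_gt0.
rewrite -mulnA mulnC leq_mul2r orbC le_dk //.
by rewrite cardK -expnM mulnC -Dk.
Qed.

End QuadraticExtension.

(** * The concrete f and h, and the theorem *)

(** The powers of X + theta^q cancel, and those of X + theta keep the coefficient (theta - theta^q)
    / (theta^q - theta) = -1. *)
Lemma QnumL_add_QdenL (F : finFieldType) (L : fieldExtType F) (theta : L) t :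
  theta ^+ #|F| - theta != 0 ->
  QnumL theta t + theta *: QdenL theta t = - ('X + theta%:P) ^+ t.
Proof.
move=> d_neq0; rewrite /QnumL /QdenL [theta *: (_ *: _)]scalerA mulrC.
rewrite -scalerA -scalerDr.
rewrite [theta *: (_ - _)]scalerBr [X in _ *: X]addrC subrKA -scalerBl.
by rewrite -[theta - _]opprB scaleNr scalerN scalerA mulVf // scale1r.
Qed.

Lemma QnumL_add_conj_QdenL (F : finFieldType) (L : fieldExtType F)
    (theta : L) t :
  theta ^+ #|F| - theta != 0 ->
  QnumL theta t + theta ^+ #|F| *: QdenL theta t =
    - ('X + (theta ^+ #|F|)%:P) ^+ t.
Proof.
move=> d_neq0; rewrite /QnumL /QdenL [_ ^+ _ *: (_ *: _)]scalerA mulrC.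
rewrite -scalerA -scalerDr.
rewrite [_ ^+ _ *: (_ - _)]scalerBr subrKA -scalerBl.
by rewrite -[theta - _]opprB scaleNr scalerN scalerA mulVf // scale1r.
Qed.

Lemma card_finvect (F : finFieldType) (L : fieldExtType F) :
  #|finvect_type L| = (#|F| ^ \dim {:L})%N.
Proof.
pose cL := Vector.class (finvect_type L : vectType F).
by rewrite -(@card_vspacef F (finvect_type L) cL) card_vspace.
Qed.

Theorem theorem5p3 (F : finFieldType) (L : fieldExtType F)
  (c : F) (theta : L) (t n : nat) (g : {poly F}) (r : {poly L})
  (dimL : \dim {:L} = 2%N)
  (irr_c : irreducible_poly ('X^2 - 'X - c%:P))
  (root_theta : root (map_poly (in_alg L) ('X^2 - 'X - c%:P)) theta)
  (t_ge2 : (2 <= t)%N)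
  (t_primes : forall l : nat, prime l -> (l %| t)%N -> (l %| #|F| ^ 2 - 1)%N)
  (irr_g : irreducible_poly g)
  (deg_g : (size g).-1 = n)
  (g_theta : (map_poly (in_alg L) g).[- theta] != 0)
  (r_factor : ~~ odd n ->
     irreducible_poly r /\ r %| map_poly (in_alg L) g)
  (odd_nonpower : odd n -> forall l : nat, prime l -> (l %| t)%N ->
     ~ exists y : L, y ^+ l =
         (map_poly (in_alg L) g).[- theta ^+ #|F|]
         / (map_poly (in_alg L) g).[- theta])
  (even_nonpower : ~~ odd n -> forall l : nat, prime l -> (l %| t)%N ->
     ~ exists y : L, y ^+ l = r.[- theta ^+ #|F|] / r.[- theta]) :
  odd n \/ (4 %| n * t)%N ->
  forall m : nat, irreducible_poly (iter m (Qtrans theta t) g).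
Proof.
(* [finvect_type] puts a finite field structure on L itself, so polynomials over L are reused over
   K. *)
move=> _ m; pose K : finFieldType := finvect_type L.
pose i : {rmorphism F -> K} := in_alg L.
have cardK : #|K| = (#|F| ^ 2)%N.
  by rewrite -dimL -card_finvect.
have [S [j _]] := countable_algebraic_closure K.
have d_neq0 := conj_neq irr_c root_theta.
have fhA := QnumL_add_QdenL t d_neq0.
have fhB := QnumL_add_conj_QdenL t d_neq0.
rewrite -(Qnum_embed theta t dimL) -(Qden_embed theta t dimL) in fhA fhB.
(* Both parities are merged: r' is g itself for n odd, where it stays irreducible over K, and r for
   n even. *)
have [r' [irr_r' r'_dv nonpow]] : exists r' : {poly K}, [/\ irreducible_poly r',
  r' %| map_poly i g & forall l, prime l -> (l %| t)%N ->
     ~ exists y : K, y ^+ l = r'.[- theta ^+ #|F|] / r'.[- theta]].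
  have [n_odd | n_even] := boolP (odd n).
    exists (map_poly i g); split=> //; last exact: odd_nonpower.
    by have := irreducible_odd_extension i cardK j irr_g; rewrite deg_g; apply.
  have [irr_r r_dv] := r_factor n_even.
  by exists r; split=> //; exact: even_nonpower.
have ab : (theta : K) != theta ^+ #|F| by rewrite eq_sym -subr_eq0.
apply: (iter_homog_subst_irreducible cardK j (ltnW t_ge2) ab fhA fhB irr_g
  g_theta irr_r' r'_dv).
- by move=> l pr_l l_dv; rewrite cardK t_primes.
- move=> l pr_l l_dv y; apply/eqP => yl.
  by case: (nonpow l pr_l l_dv); exists y.
Qed.
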